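(* Let $n$ important samples $p_1,\dots,p_n\in\Gamma_N$ be selected by the greedy procedure described in the context, and let $p\in\Gamma_N\setminus\{p_1,\dots,p_n\}$ be one of the remaining samples. Write $\bm u^H=\bm u^H(p)$, let $\hat{\bm u}^H=\sum_{j=1}^n c^L_j\,\bm u^H(p_j)$ be its bi-fidelity approximation, and let $\bm c^L,\bm c^H$ be the low- and high-fidelity coefficient vectors associated with $p$. Assume that the low- and high-fidelity coefficients are close, i.e. $$\|\bm c^H-\bm c^L\|\le \epsilon,$$ and that the ratio $$\delta=\frac{\|\bm u^H-\mathrm{P}_{\bm U^H_{\Gamma_n}}\bm u^H\|}{\|\mathrm{P}_{\bm U^H_{\Gamma_n}}\bm u^H-\hat{\bm u}^H\|}$$ is small, i.e. $\delta\ll 1$. Then $$\|\bm u^H-\hat{\bm u}^H\|\le \epsilon(1+\delta)\sqrt{\sigma_{\max}(\bm G^H)},$$ where $\sigma_{\max}(\bm G^H)$ is the largest singular value of the high-resolution Gramian $\bm G^H$.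
   Context: Let $\bm P$ be a parameter set, and let $\bm u^L:\bm P\to\bm U^L$ and $\bm u^H:\bm P\to\bm U^H$ be the low-resolution (coarse mesh) and high-resolution (fine mesh) models, where $\bm U^L,\bm U^H$ are finite-dimensional Hilbert spaces with inner products $\langle\cdot,\cdot\rangle^L,\langle\cdot,\cdot\rangle^H$ and dimensions $N^L_{dof}<N^H_{dof}$. Let $\Gamma_N\subset\bm P$ be a finite set of $N$ parameter samples. Greedy procedure: set $\Gamma_0=\emptyset$ and, for $k=1,\dots,n$ (with $n\ll N$), $$p_k=\operatorname{arg\,max}_{q\in\Gamma_N} d^L\big(\bm u^L(q),\bm U^L(\Gamma_{k-1})\big),\qquad \Gamma_k=\Gamma_{k-1}\cup\{p_k\},$$ where $\bm U^L(\Gamma_k)=\operatorname{span}\{\bm u^L(p_1),\dots,\bm u^L(p_k)\}$ and $d^L(x,Y)=\inf_{y\in Y}\|x-y\|^L$, with $\|\cdot\|^L$ the norm of $\bm U^L$. Gramians and coefficients: $\bm G^L_{ij}=\langle\bm u^L(p_i),\bm u^L(p_j)\rangle^L$ and $\bm G^H_{ij}=\langle\bm u^H(p_i),\bm u^H(p_j)\rangle^H$ for $1\le i,j\le n$. For $p\in\Gamma_N\setminus\{p_1,\dots,p_n\}$ let $f^L_i=\langle\bm u^L(p_i),\bm u^L(p)\rangle^L$ and $f^H_i=\langle\bm u^H(p_i),\bm u^H(p)\rangle^H$, $1\le i\le n$. The coefficient vectors are obtained from $\bm G^L\bm c^L=\bm f^L$ and $\bm G^H\bm c^H=\bm f^H$.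 $\bm U^H_{\Gamma_n}=\operatorname{span}\{\bm u^H(p_1),\dots,\bm u^H(p_n)\}$, and $\mathrm{P}_{\bm U^H_{\Gamma_n}}$ is the $\bm U^H$-orthogonal projector onto $\bm U^H_{\Gamma_n}$, so that $\mathrm{P}_{\bm U^H_{\Gamma_n}}\bm u^H(p)=\sum_{j=1}^n c^H_j\,\bm u^H(p_j)$. For elements of $\bm U^H$, $\|\cdot\|$ is the norm induced by $\langle\cdot,\cdot\rangle^H$; for coefficient vectors it is the Euclidean norm. *)

(* Defs.v *)
From HB Require Import structures.
From mathcomp Require Import all_boot all_order all_algebra.
From mathcomp Require Import finmap.
From mathcomp Require Import all_classical all_reals.

Set Implicit Arguments.
Unset Strict Implicit.
Unset Printing Implicit Defensive.

Import Order.TTheory GRing.Theory Num.Theory.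
Local Open Scope classical_set_scope.
Local Open Scope ring_scope.

(* A finite-dimensional real Hilbert space is a [vectType R] with a positive
   definite symmetric form [{dot U for idfun}]. Completeness is automatic. *)
Section InnerProduct.
Variables (R : realType) (U : vectType R) (ip : {dot U for idfun}).

Definition ipnorm (x : U) : R := Num.sqrt (ip x x).

Definition dist (x : U) (Y : {vspace U}) : R :=
  inf [set ipnorm (x - y) | y in [set y : U | y \in Y]].

(* Projection onto W along its orthogonal complement; positive definiteness
   makes the two subspaces complementary. *)
Definition orth_proj (W : {vspace U}) : 'End(U) := daddv_pi W (orthov ip W).

End InnerProduct.

Section Matrices.
Variable R : realType.

(* [`|c|] is the max norm on matrices, hence the explicit Euclidean norm. *)
Definition euclid_norm (n : nat) (c : 'cV[R]_n) : R :=
  Num.sqrt (\sum_(i < n) c i 0 ^+ 2).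

Definition singular_values (m n : nat) (A : 'M[R]_(m, n)) : set R :=
  [set Num.sqrt a | a in [set a : R | eigenvalue (A^T *m A) a]].

(* For 0 < n the set is finite and nonempty, so the supremum is a maximum. *)
Definition sigma_max (m n : nat) (A : 'M[R]_(m, n)) : R :=
  sup (singular_values A).

End Matrices.

Section Model.
Variables (R : realType) (P : choiceType) (U : vectType R).
Variables (ip : {dot U for idfun}) (u : P -> U).

Definition model_span (s : seq P) : {vspace U} := <<[seq u p | p <- s]>>%VS.

Definition gramian (n : nat) (ps : n.-tuple P) : 'M[R]_n :=
  \matrix_(i, j) ip (u (tnth ps i)) (u (tnth ps j)).

Definition gram_rhs (n : nat) (ps : n.-tuple P) (p : P) : 'cV[R]_n :=
  \col_i ip (u (tnth ps i)) (u p).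

Definition lin_comb (n : nat) (ps : n.-tuple P) (c : 'cV[R]_n) : U :=
  \sum_(j < n) c j 0 *: u (tnth ps j).

(* Ties in the arg max may be broken arbitrarily. With indices starting at 0,
   the set selected before step k is [take k ps]. *)
Definition greedy (Gamma : {fset P}) (n : nat) (ps : n.-tuple P) : Prop :=
  forall k : 'I_n,
    tnth ps k \in Gamma /\
    forall q : P, q \in Gamma ->
      dist ip (u q) (model_span (take k ps)) <=
      dist ip (u (tnth ps k)) (model_span (take k ps)).

End Model.

(* Main.v *)
(** Orthogonality of [u^H - P u^H] to the span gives
    [|u^H - uhat| <= (1 + delta) |P u^H - uhat|], and
    [|P u^H - uhat|^2] is the Gram quadratic form at [c^H - c^L], which is
    controlled by the largest eigenvalue of [G^H].  That eigenvalue is produced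
    by maximising the Rayleigh quotient on the compact unit sphere. *)
Require Import Defs.
From HB Require Import structures.
From mathcomp Require Import all_boot all_order all_algebra.
From mathcomp Require Import finmap.
From mathcomp Require Import all_classical all_reals.
From mathcomp Require Import topology normedtype derive.
From mathcomp Require Import ring lra.

Import Order.TTheory GRing.Theory Num.Theory.
Import numFieldNormedType.Exports.
Local Open Scope ring_scope.

Lemma cvg_bigsum {R : realType} {T I : Type} (F : set_system T)
    {FF : Filter F} (r : seq I) (f : I -> T -> R) (l : I -> R) :
  (forall i, f i x @[x --> F] --> l i)%classic ->
  (\sum_(i <- r) f i x @[x --> F] --> \sum_(i <- r) l i)%classic.
Proof.
move=> fl; elim: r => [|i r IH].
  by under eq_fun do rewrite big_nil; rewrite big_nil; exact: cvg_cst.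
under eq_fun do rewrite big_cons.
by rewrite big_cons; apply: cvgD.
Qed.

(** * Quadratic forms of symmetric matrices and the Rayleigh quotient *)

Section Rayleigh.
Context {R : realType} {n : nat}.
Implicit Types (v w : 'rV[R]_n) (A : 'M[R]_n).

(** Row vectors are used because [eigenvalue] refers to solutions of [v *m A = a *: v]. *)
Definition bform A v w : R := (v *m A *m w^T) 0 0.

Definition sqn v : R := \sum_i v 0 i ^+ 2.

(** Seen as the form of the identity matrix, [sqn] inherits the scaling rule and continuity from
    [bform]. *)
Lemma bform1 v : bform 1%:M v v = sqn v.
Proof.
rewrite /bform mulmx1 mxE; apply: eq_bigr => i _.
by rewrite mxE expr2.
Qed.

Lemma sqn_ge0 v : 0 <= sqn v.
Proof. by apply: sumr_ge0 => i _; exact: sqr_ge0. Qed.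

Lemma sqn_eq0 v : (sqn v == 0) = (v == 0).
Proof.
apply/eqP/eqP => [v0|->]; last by rewrite /sqn big1// => i _; rewrite mxE expr0n.
apply/rowP => i; rewrite mxE; apply/eqP; rewrite -sqrf_eq0.
by rewrite (psumr_eq0P _ v0)// => j _; exact: sqr_ge0.
Qed.

Lemma bformE A v w : bform A v w = \sum_j (\sum_i v 0 i * A i j) * w 0 j.
Proof. by rewrite /bform mxE; apply: eq_bigr => j _; rewrite !mxE. Qed.

Lemma bformZ A (a : R) v : bform A (a *: v) (a *: v) = a ^+ 2 * bform A v v.
Proof. by rewrite /bform linearZ /= -!scalemxAl -scalemxAr !mxE expr2 mulrA. Qed.

Lemma sqnZ (a : R) v : sqn (a *: v) = a ^+ 2 * sqn v.
Proof. by rewrite -!bform1 bformZ. Qed.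

Lemma bformC A v w : A^T = A -> bform A v w = bform A w v.
Proof.
move=> As; rewrite /bform -[in LHS](trmxK (v *m A *m w^T)) mxE.
by rewrite !trmx_mul trmxK As mulmxA.
Qed.

Lemma bformD A v w (t : R) : A^T = A ->
  bform A (v + t *: w) (v + t *: w) =
  bform A v v + 2 * t * bform A v w + t ^+ 2 * bform A w w.
Proof.
move=> As.
have -> : bform A (v + t *: w) (v + t *: w) =
    bform A v v + t * bform A v w + t * bform A w v + t ^+ 2 * bform A w w.
  rewrite /bform linearD linearZ /= !mulmxDl !mulmxDr -!scalemxAl -!scalemxAr.
  by rewrite scalerA !mxE; ring.
by rewrite (bformC _ w v As); ring.
Qed.

(* [v] minimises the form, so its derivative at [v] in the direction [v *m A],
   namely [2 * sqn (v *m A)], must vanish; the step [- s / (k + 1)] makes this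
   quantitative. *)
Lemma psd_isotropic_ker A v : A^T = A -> (forall w, 0 <= bform A w w) ->
  bform A v v = 0 -> v *m A = 0.
Proof.
move=> As Apos v0; apply/eqP; rewrite -sqn_eq0.
set w := v *m A.
have Evw : bform A v w = sqn w by rewrite -bform1 /bform mulmx1.
set s := sqn w in Evw *; set k := bform A w w.
have k1 : 0 < k + 1 by have := Apos w; rewrite -/k; lra.
have := Apos (v + (- (s / (k + 1))) *: w).
rewrite (bformD _ _ _ _ As) v0 Evw -/k.
have -> : 0 + 2 * - (s / (k + 1)) * s + (- (s / (k + 1))) ^+ 2 * k =
  - ((s / (k + 1)) ^+ 2 * (k + 2)) by field; rewrite gt_eqF.
rewrite oppr_ge0 pmulr_lle0; last by lra.
move=> h; have /eqP : (s / (k + 1)) ^+ 2 = 0 by apply/eqP; rewrite eq_le h sqr_ge0.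
by rewrite sqrf_eq0 mulf_eq0 invr_eq0 (gt_eqF k1) orbF.
Qed.

Lemma bform_continuous A : continuous (fun v => bform A v v).
Proof.
move=> v; rewrite /continuous_at bformE; under eq_fun do rewrite bformE.
apply: (@cvg_bigsum R _ _ (nbhs v) _) => j; apply: cvgM; last exact: coord_continuous.
apply: (@cvg_bigsum R _ _ (nbhs v) _) => i; apply: cvgM; last exact: cvg_cst.
exact: coord_continuous.
Qed.

(** Bounded: each squared coordinate is one term of [sqn v = 1], so the max norm is at most 1.
    Closed: it is the preimage of a point under a continuous form. *)
Lemma sphere_compact : compact [set v : 'rV[R]_n | sqn v = 1]%classic.
Proof.
apply: bounded_closed_compact.
  exists 1; split; first exact: num_real.
  move=> M M1 v /= v1; rewrite [leLHS]/Num.norm /= mx_normrE.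
  apply: bigmax_le => [|[i j] _ /=]; first lra.
  rewrite ord1; apply: le_trans (ltW M1).
  rewrite -(@ler_pXn2r _ 2)// ?nnegrE// expr1n -v1 /sqn (bigD1 j)//=.
  rewrite real_normK ?num_real// lerDl.
  by apply: sumr_ge0 => k _; exact: sqr_ge0.
have -> : [set v : 'rV[R]_n | sqn v = 1]%classic =
    ((fun v => bform 1%:M v v) @^-1` [set 1])%classic.
  by apply/seteqP; split => v /=; rewrite bform1.
apply: preimage_closed; last exact: closed_eq.
by move=> v _; exact: bform_continuous.
Qed.

(** Let the form attain its maximum [m] over the unit sphere at [c]. By homogeneity [m%:M - A] is
    positive semidefinite, and [c] is isotropic for it. Hence [c] lies in its kernel, which makes
    [c] an eigenvector for [m]. *)
Lemma rayleigh_max A : (0 < n)%N -> A^T = A ->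
  exists2 m, eigenvalue A m & forall v, bform A v v <= m * sqn v.
Proof.
move=> n0 As.
have sph0 : ([set v : 'rV[R]_n | sqn v = 1] !=set0)%classic.
  exists (delta_mx 0 (Ordinal n0)); rewrite /= /sqn (bigD1 (Ordinal n0))//=.
  by rewrite mxE !eqxx expr1n big1 ?addr0// => i /negbTE i0; rewrite mxE i0 expr0n.
have [c] := EVT_max_rV sph0 sphere_compact (continuous_subspaceT (bform_continuous A)).
rewrite inE /= => c1 cmax; set m := bform A c c in cmax *.
have mmax v : bform A v v <= m * sqn v.
  have [->|v0] := eqVneq v 0.
    by rewrite /bform /sqn !mul0mx mxE big1 ?mulr0// => i _; rewrite mxE expr0n.
  have sv : 0 < sqn v by rewrite lt_def sqn_eq0 v0 sqn_ge0.
  (* Normalise [v] to compare it with [c]; both sides are homogeneous of degree 2. *)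
  have := cmax ((Num.sqrt (sqn v))^-1 *: v).
  rewrite inE /= sqnZ bformZ exprVn sqr_sqrtr ?sqn_ge0// mulVf ?gt_eqF//.
  by move=> /(_ erefl); rewrite mulrC ler_pdivrMr.
exists m => //; apply/eigenvalueP; exists c; last first.
  by rewrite -sqn_eq0 c1 oner_eq0.
have bformB w : bform (m%:M - A) w w = m * sqn w - bform A w w.
  by rewrite -bform1 /bform mulmxBr mulmxBl mul_mx_scalar mulmx1 -scalemxAl !mxE.
have : c *m (m%:M - A) = 0.
  apply: psd_isotropic_ker => [|w|].
  - by rewrite linearB /= tr_scalar_mx As.
  - by rewrite bformB subr_ge0.
  - by rewrite bformB c1 mulr1 subrr.
by rewrite mulmxBr mul_mx_scalar => /eqP; rewrite subr_eq0 => /eqP.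
Qed.

(** For symmetric [A] an eigenvalue [m] yields the eigenvalue [m ^+ 2] of [A^T *m A], so [m] is
    bounded by the singular value [|m|]. *)
Lemma bform_le_sigma_max A v : (0 < n)%N -> A^T = A ->
  bform A v v <= sigma_max A * sqn v.
Proof.
move=> n0 As; have [m /eigenvalueP[c cA c0] mA] := rayleigh_max A n0 As.
apply: le_trans (mA v) _; apply: (ler_wpM2r (sqn_ge0 v)).
apply: le_trans (ler_norm m) _; apply: ub_le_sup; last first.
  exists (m ^+ 2); last exact: sqrtr_sqr.
  apply/eigenvalueP; exists c => //.
  by rewrite As mulmxA cA -scalemxAl cA scalerA expr2.
(* [sup] dominates its elements only for a set bounded above. The Rayleigh maximum [M] of [A^T *m A]
   bounds all its eigenvalues, so the root of [M] bounds the singular values. *)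
have [|M _ MA] := rayleigh_max (A^T *m A) n0; first by rewrite trmx_mul trmxK.
exists (Num.sqrt M) => _ [a /eigenvalueP[w wA w0] <-]; apply: ler_wsqrtr.
have sw : 0 < sqn w by rewrite lt_def sqn_eq0 w0 sqn_ge0.
rewrite -(ler_pM2r sw); apply: le_trans (MA w).
by rewrite /bform wA -scalemxAl mxE -bform1 /bform mulmx1.
Qed.

End Rayleigh.

(** * Orthogonality and orthogonal projection *)

Section InnerProductGeometry.
Context {R : realType} {U : vectType R} (ip : {dot U for idfun}).

Lemma ip_sym x y : ip x y = ip y x.
Proof. by rewrite hermC expr0 mul1r. Qed.

Lemma ip_ge0 x : 0 <= ip x x.
Proof.
have [->|x0] := eqVneq x 0; first by rewrite linear0r.
exact/ltW/neq0_dnorm_gt0.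
Qed.

(** By Pythagoras the squares of the two sides differ by twice the product of the norms. *)
Lemma ipnorm_orthD_le x y : ip x y = 0 ->
  ipnorm ip (x + y) <= ipnorm ip x + ipnorm ip y.
Proof.
move=> xy0; rewrite -(@ler_pXn2r _ 2)// ?nnegrE ?addr_ge0 ?sqrtr_ge0//.
rewrite sqr_sqrtr ?ip_ge0// linearDr /= !linearDl /= xy0 (ip_sym y) xy0.
rewrite sqrrD !sqr_sqrtr ?ip_ge0// addr0 add0r lerD2r lerDl.
by rewrite mulrn_wge0// mulr_ge0 ?sqrtr_ge0.
Qed.

(** Definiteness makes [W] and its orthogonal complement meet in 0, so the projection fixes [x] and
    kills [u - x]. *)
Lemma orth_proj_unique (W : {vspace U}) x u : x \in W ->
  (u - x) \in orthov ip W -> orth_proj ip W u = x.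
Proof.
move=> xW uxW; have W0 : (W :&: orthov ip W = 0)%VS.
  apply/eqP; rewrite -subv0; apply/subvP => y; rewrite memv_cap memv0.
  move=> /andP[yW /mem_orthovP/(_ _ yW) yy0].
  by apply/negP => /negP /(neq0_dnorm_gt0 (s := ip)); rewrite yy0 ltxx.
rewrite /orth_proj -{1}(subrK x u) linearD /= (daddv_pi_id W0 xW).
have V0 : (orthov ip W :&: W = 0)%VS by rewrite capvC.
(* The two complementary projections of [u - x] add up to [u - x], and the one onto the complement
   already gives all of it. *)
have := daddv_pi_add W0 (subvP (addvSr W _) _ uxW).
by rewrite (daddv_pi_id V0 uxW) => /(canRL (addrK _)) ->; rewrite subrr add0r.
Qed.

End InnerProductGeometry.

(** * Gram matrices and the normal equations *)

Section Gramian.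
Context {R : realType} {P : choiceType} {U : vectType R}.
Context (ip : {dot U for idfun}) (u : P -> U) {n : nat} (ps : n.-tuple P).

Lemma trmx_gramian : (gramian ip u ps)^T = gramian ip u ps.
Proof. by apply/matrixP => i j; rewrite !mxE ip_sym. Qed.

Lemma ip_lin_combl (c : 'cV[R]_n) x :
  ip (lin_comb u ps c) x = \sum_j c j 0 * ip (u (tnth ps j)) x.
Proof.
by rewrite /lin_comb linear_sumlz; apply: eq_bigr => j _; rewrite linearZl.
Qed.

Lemma lin_combB (c d : 'cV[R]_n) :
  lin_comb u ps c - lin_comb u ps d = lin_comb u ps (c - d).
Proof.
by rewrite /lin_comb -sumrB; apply: eq_bigr => j _; rewrite !mxE scalerBl.
Qed.

Lemma mem_lin_comb (c : 'cV[R]_n) : lin_comb u ps c \in model_span u ps.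
Proof.
apply: memv_suml => j _; apply: memvZ; apply: memv_span.
by apply: map_f; exact: mem_tnth.
Qed.

Lemma ip_lin_comb (c : 'cV[R]_n) :
  ip (lin_comb u ps c) (lin_comb u ps c) = bform (gramian ip u ps) c^T c^T.
Proof.
rewrite bformE ip_lin_combl; apply: eq_bigr => j _.
rewrite ip_sym ip_lin_combl !mxE mulrC; congr (_ * _).
by apply: eq_bigr => i _; rewrite !mxE.
Qed.

(** Row [i] of the normal equations says that the residual is orthogonal to the generator
    [u (tnth ps i)]; orthogonality to the span follows. *)
Lemma gram_solution_orthov (c : 'cV[R]_n) p :
  gramian ip u ps *m c = gram_rhs ip u ps p ->
  u p - lin_comb u ps c \in orthov ip (model_span u ps).
Proof.
move=> hc; rewrite mem_orthov_sym; apply/span_subvP => _ /mapP[q /tnthP[i ->] ->].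
have := congr1 (fun d : 'cV[R]_n => d i 0) hc; rewrite !mxE => hci.
rewrite mem_orthov1 linearB /= -hci subr_eq0 ip_sym ip_lin_combl.
by apply/eqP/eq_bigr => j _; rewrite mxE mulrC ip_sym.
Qed.

Lemma orth_proj_gram_solution (c : 'cV[R]_n) p :
  gramian ip u ps *m c = gram_rhs ip u ps p ->
  orth_proj ip (model_span u ps) (u p) = lin_comb u ps c.
Proof.
move=> hc; apply: orth_proj_unique; first exact: mem_lin_comb.
exact: gram_solution_orthov.
Qed.

Lemma ipnorm_lin_comb_le (c : 'cV[R]_n) : (0 < n)%N ->
  ipnorm ip (lin_comb u ps c) <=
    euclid_norm c * Num.sqrt (sigma_max (gramian ip u ps)).
Proof.
move=> n0; have := bform_le_sigma_max _ c^T n0 trmx_gramian.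
rewrite -ip_lin_comb => /ler_wsqrtr/le_trans; apply.
have -> : sqn c^T = \sum_(i < n) c i 0 ^+ 2.
  by apply: eq_bigr => i _; rewrite mxE.
by rewrite mulrC sqrtrM// sumr_ge0// => i _; exact: sqr_ge0.
Qed.

End Gramian.

Theorem lemma1 (R : realType) (P : choiceType) (UL UH : vectType R)
  (ipL : {dot UL for idfun}) (ipH : {dot UH for idfun})
  (hdim : (\dim {:UL} < \dim {:UH})%N)
  (uL : P -> UL) (uH : P -> UH)
  (Gamma : {fset P}) (N n : nat) (hN : #|` Gamma|%fset = N) (hn : (0 < n < N)%N)
  (ps : n.-tuple P) (hps : greedy ipL uL Gamma ps)
  (p : P) (hpGamma : p \in Gamma) (hpps : p \notin ps)
  (cL cH : 'cV[R]_n)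
  (hcL : gramian ipL uL ps *m cL = gram_rhs ipL uL ps p)
  (hcH : gramian ipH uH ps *m cH = gram_rhs ipH uH ps p)
  (epsilon : R) (hepsilon : euclid_norm (cH - cL) <= epsilon) :
  let Pu := orth_proj ipH (model_span uH ps) (uH p) in
  let uhat := lin_comb uH ps cL in
  let delta := ipnorm ipH (uH p - Pu) / ipnorm ipH (Pu - uhat) in
  ipnorm ipH (Pu - uhat) != 0 ->
  delta < 1 ->
  ipnorm ipH (uH p - uhat)
    <= epsilon * (1 + delta) * Num.sqrt (sigma_max (gramian ipH uH ps)).
Proof.
move=> Pu uhat delta b0 _.
have PuE : Pu = lin_comb uH ps cH by exact: orth_proj_gram_solution.
have delta0 : 0 <= delta by rewrite divr_ge0 ?sqrtr_ge0.
have -> : uH p - uhat = (uH p - Pu) + (Pu - uhat) by rewrite addrA subrK.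
(* [Pu] and [uhat] are both combinations of the snapshots, so their difference lies in the span to
   which the residual is orthogonal. *)
have orth : ipH (uH p - Pu) (Pu - uhat) = 0.
  have /mem_orthovP := gram_solution_orthov ipH uH ps cH p hcH; rewrite -PuE; apply.
  by rewrite PuE lin_combB; exact: mem_lin_comb.
apply: le_trans (ipnorm_orthD_le _ _ _ orth) _.
(* With a nonzero denominator the residual norm equals [delta] times the norm of [Pu - uhat], so the
   sum factors through [1 + delta]. *)
rewrite -[X in X + _](divfK b0) -/delta -[X in _ + X]mul1r -mulrDl addrC.
rewrite [epsilon * _]mulrC -mulrA ler_wpM2l ?addr_ge0//.
rewrite PuE lin_combB; have /andP[n0 _] := hn.
apply: le_trans (ipnorm_lin_comb_le _ _ _ _ n0) _.
by rewrite ler_wpM2r ?sqrtr_ge0.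
Qed.
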